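(* Let $d\ge 2$ be a fixed integer. There is a class of instances of the $(d+1)$-dimensional knapsack problem with groups (one weight to be minimized and $d$ profits to be maximized) with the following property: for every number $n$ of objects and every maximum density $\phi\ge1$, the class contains an instance with $n$ objects whose profits are drawn independently according to densities bounded by $\phi$, and whose expected number of Pareto optimal solutions is \[ \Omega\left(\min\left\{(n\phi)^{(d-\log d)\cdot(1-\Theta(1/\phi))},\ 2^{\Theta(n)}\right\}\right). \]
   Context: Restricted multi-profit knapsack problem: there are $n$ objects $a_1,\dots,a_n$; object $a_i$ has a weight $w_i\in\mathbb{R}$ and a profit vector $p_i\in\mathbb{R}^d$. A solution is a vector $s\in\{0,1\}^n$, and a set $\mathcal{S}\subseteq\{0,1\}^n$ of feasible solutions is given. The objectives are to minimize $\sum_i w_i s_i$ and to maximize every $\sum_i (p_i)_j s_i$, $j=1,\dots,d$, over $s\in\mathcal{S}$. A feasible solution $s'$ dominates a feasible solution $s$ if it is not worse in any objective and strictly better in at least one; a feasible solution is Pareto optimal if no feasible solution dominates it. In the knapsack problem with groups, $\mathcal{S}=\prod_{i=1}^k\mathcal{S}_i$ with $\mathcal{S}_i\subseteq\{0,1\}^{n_i}$, $\sum_i n_i=n$, for a partition of the objects into groups. Smoothing model: weights and $\mathcal{S}$ are adversarial, and each profit $(p_i)_j$ is drawn independently according to an adversarial density $f_{i,j}:[-1,1]\to\mathbb{R}$ with $f_{i,j}\le\phi$. The constants hidden in the asymptotic notation may depend on $d$; $\log$ is base $2$. *)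

(* Defs.v *)
From HB Require Import structures.
From mathcomp Require Import all_boot all_order all_algebra.
From mathcomp Require Import all_classical all_reals all_analysis.

Set Implicit Arguments.
Unset Strict Implicit.
Unset Printing Implicit Defensive.

Import Order.TTheory GRing.Theory Num.Theory.
Import numFieldNormedType.Exports.

Local Open Scope classical_set_scope.
Local Open Scope ring_scope.

Definition log2 (R : realType) (x : R) : R := ln x / ln 2.

Section pareto.
Variables (R : realType) (n d : nat).

Definition solution := {ffun 'I_n -> bool}.

Variables (w : 'I_n -> R) (p : 'I_n -> 'I_d -> R).

Definition weight (s : solution) : R := \sum_(i < n) w i * (s i)%:R.

Definition profit (s : solution) (j : 'I_d) : R :=
  \sum_(i < n) p i j * (s i)%:R.

Definition dominates (s' s : solution) : bool :=
  [&& weight s' <= weight s,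
      [forall j, profit s j <= profit s' j] &
      (weight s' < weight s) || [exists j, profit s j < profit s' j]].

Definition pareto_set (S : {set solution}) : {set solution} :=
  [set s in S | [forall s' in S, ~~ dominates s' s]]%SET.

End pareto.

(* The i-th group consists of the objects o with kp_group o = i, and
   kp_feasible i is the set S_i of the feasible sub-solutions on that group.
   Only the values of kp_density on [-1, 1] are used. *)
Record group_knapsack (R : realType) (d n : nat) := GroupKnapsack {
  kp_k : nat;
  kp_group : 'I_n -> 'I_kp_k;
  kp_feasible : forall i : 'I_kp_k,
    {set {ffun {o : 'I_n | kp_group o == i} -> bool}};
  kp_weight : 'I_n -> R;
  kp_density : 'I_n -> 'I_d -> R -> R
}.

(* The product of the sets S_i. *)
Definition feasible_set (R : realType) (d n : nat)
    (I : group_knapsack R d n) : {set solution n} :=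
  [set s : solution n | [forall i : 'I_(kp_k I),
     [ffun o : {o : 'I_n | kp_group I o == i} => s (val o)]
       \in kp_feasible i]]%SET.

Definition is_density (R : realType) (f : R -> R) : Prop :=
  [/\ measurable_fun (`[-1, 1] : set R) f,
      (forall x, -1 <= x <= 1 -> 0 <= f x) &
      (\int[@lebesgue_measure R]_(x in `[(-1)%R, 1%R]) (f x)%:E = 1)%E].

Definition valid_smoothing (R : realType) (d n : nat) (phi : R)
    (I : group_knapsack R d n) : Prop :=
  forall (i : 'I_n) (j : 'I_d),
    is_density (kp_density I i j) /\
    (forall x, -1 <= x <= 1 -> kp_density I i j x <= phi).

Definition has_density (dT : measure_display) (T : measurableType dT)
    (R : realType) (P : probability T R) (X : {RV P >-> R})
    (f : R -> R) : Prop :=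
  forall A : set R, measurable A ->
    (distribution P X A =
     \int[@lebesgue_measure R]_(x in A `&` `[(-1)%R, 1%R]) (f x)%:E)%E.

Definition mutually_independent (dT : measure_display)
    (T : measurableType dT) (R : realType) (P : probability T R)
    (K : finType) (X : K -> {RV P >-> R}) : Prop :=
  forall (J : {set K}) (A : K -> set R),
    (forall k, measurable (A k)) ->
    (P (\bigcap_(k in [set k | k \in J]) X k @^-1` A k) =
     \prod_(k in J) P (X k @^-1` A k))%E.

Definition drawn_from (dT : measure_display) (T : measurableType dT)
    (R : realType) (P : probability T R) (d n : nat)
    (I : group_knapsack R d n) (p : 'I_n -> 'I_d -> {RV P >-> R}) : Prop :=
  mutually_independent (fun ij : 'I_n * 'I_d => p ij.1 ij.2) /\
  (forall i j, has_density (p i j) (kp_density I i j)).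

Definition expected_pareto (dT : measure_display) (T : measurableType dT)
    (R : realType) (P : probability T R) (d n : nat)
    (I : group_knapsack R d n) (p : 'I_n -> 'I_d -> {RV P >-> R}) : \bar R :=
  'E_P[fun t => #|pareto_set (kp_weight I) (fun i j => p i j t)
                             (feasible_set I)|%:R]%E.

(* f = Theta(u), uniformly over the whole range n >= 1, phi >= 1. *)
Definition is_Theta (R : realType) (f u : nat -> R -> R) : Prop :=
  exists a b : R, [/\ 0 < a, 0 < b &
    forall (n : nat) (phi : R), (1 <= n)%N -> 1 <= phi ->
      a * u n phi <= f n phi <= b * u n phi].

(* Main.v *)
(* Put the objects into blocks that have to be taken completely or not at all,
   and let the weight of object i be 2^i, so that the heavier of two solutions is
   the one containing the last block where they differ.  The blocks come in rounds
   of d, one for each profit: the block of round r for profit j has total profit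
   about z_r in coordinate j, while in the other coordinates its objects only
   carry the noise of their densities, uniform on intervals of length 1 / phi.
   If z_r exceeds everything the earlier blocks can contribute to profit j, then
   the heavier solution always wins in profit j for the j of the last differing
   block, so almost surely every feasible solution is Pareto optimal and no
   probabilistic estimate is needed.  This holds for z_r = (8 d^2 / phi) b^r with
   b = 2 + 1 / d, once phi >= 16 d^2.  About log_b (n phi) rounds fit into n
   objects (or about n / (2 d) rounds, if that is less), which gives 2^(d R)
   solutions for R rounds; since b^(d - 1) <= 2^d this is at least of order
   (n phi)^(d - 1), and d - 1 >= d - log d. *)
Require Import Defs.
From HB Require Import structures.
From mathcomp Require Import all_boot all_order all_algebra.
From mathcomp Require Import all_classical all_reals all_analysis.
From mathcomp Require Import measurable_realfun.
From mathcomp Require Import ring lra zify.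

Set Implicit Arguments.
Unset Strict Implicit.
Unset Printing Implicit Defensive.

Import Order.TTheory GRing.Theory Num.Theory.
Import numFieldNormedType.Exports.

Local Open Scope classical_set_scope.
Local Open Scope ring_scope.

(** * Sums over objects arranged in consecutive blocks *)

Lemma reshape_index_cons (k : nat) (sh : seq nat) (o : nat) :
  reshape_index (k :: sh) o =
    if (o < k)%N then 0%N else (reshape_index sh (o - k)).+1.
Proof.
rewrite /reshape_index /= subn_eq0.
by case: ltnP => // le_ko; rewrite subSn.
Qed.

(** Positions beyond the last block all get the index [size sh]; they give the last summand. *)
Lemma sum_reshape_index (V : nmodType) (F : nat -> V) (sh : seq nat) (n : nat) :
  (sumn sh <= n)%N ->
  \sum_(0 <= o < n) F (reshape_index sh o) =
  \sum_(0 <= t < size sh) F t *+ nth 0%N sh t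
    + F (size sh) *+ (n - sumn sh).
Proof.
elim: sh n F => [|k sh IH] n F /= len.
  by rewrite [in RHS]big_geq // add0r -sumr_const_nat; apply: eq_bigr.
have lekn : (k <= n)%N by lia.
rewrite (big_cat_nat (leq0n k) lekn) /= big_nat_recl //= -addrA; congr (_ + _).
  rewrite (eq_big_nat _ _ (F2 := fun=> F 0%N)); last first.
    by move=> o /andP[_ ltok]; rewrite reshape_index_cons ltok.
  by rewrite sumr_const_nat subn0.
have -> : (n - (k + sumn sh) = (n - k) - sumn sh)%N by lia.
rewrite -(IH _ (F \o succn)) /=; last by lia.
rewrite -{1}[k]add0n big_addn; apply: eq_big_nat => o _.
by rewrite reshape_index_cons ifN; [rewrite addnK | rewrite -leqNgt leq_addl].
Qed.

Lemma reshape_index_mono (sh : seq nat) (i j : nat) :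
  (i <= j)%N -> (reshape_index sh i <= reshape_index sh j)%N.
Proof. by rewrite (reshape_leq sh) => /orP[/ltnW | /andP[/eqP ->]]. Qed.

Lemma leq_reshape_index_size (sh : seq nat) (i : nat) :
  (reshape_index sh i <= size sh)%N.
Proof.
elim: sh i => [|k sh IH] i; first by [].
by rewrite reshape_index_cons; case: ifP => //= _; rewrite ltnS.
Qed.

(** * A deterministic criterion against domination *)

(** In the difference of the two sums, objects of [A] count in full, each object of [B] costs at
    most [v i], and all others cancel. *)
Lemma lt_sum_select (R : realType) (n : nat) (v : 'I_n -> R)
    (s s' : {ffun 'I_n -> bool}) (A B : pred 'I_n) :
  (forall i, 0 <= v i) ->
  (forall i, A i -> s i && ~~ s' i) ->
  (forall i, ~~ A i -> ~~ B i -> s i = s' i) ->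
  \sum_(i < n | B i) v i < \sum_(i < n | A i) v i ->
  \sum_(i < n) v i * (s' i)%:R < \sum_(i < n) v i * (s i)%:R.
Proof.
move=> v0 sA sN ltBA; rewrite -subr_gt0.
apply: (@lt_le_trans _ _ (\sum_(i < n | A i) v i - \sum_(i < n | B i) v i)).
  by rewrite subr_gt0.
rewrite big_mkcond [X in _ - X]big_mkcond /= -!sumrB; apply: ler_sum => i _.
have := v0 i; have := sA i; have := sN i.
case: (A i) => /=.
  move=> _ /(_ isT) /andP[-> /negbTE ->] vi0.
  by case: (B i); rewrite mulr1 mulr0 ?subrr ?subr0.
case: (B i) => /= [_ _ vi0|/(_ isT isT) -> _ _]; last by rewrite !subrr.
by case: (s i); case: (s' i); rewrite ?mulr0 ?mulr1; lra.
Qed.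

Lemma sum_pow2_lt (R : realType) (n : nat) (o : 'I_n) :
  \sum_(i < n | (i < o)%N) 2 ^+ i < 2 ^+ o :> R.
Proof.
have -> : \sum_(i < n | (i < o)%N) 2 ^+ i = \sum_(0 <= i < o) 2 ^+ i :> R.
  rewrite [RHS]big_mkord.
  by rewrite (big_ord_widen n (fun i => 2 ^+ i : R)) // ltnW.
suff -> : forall m, \sum_(0 <= i < m) 2 ^+ i = 2 ^+ m - 1 :> R.
  by rewrite ltrBlDr ltrDl.
elim=> [|m IH]; first by rewrite big_geq // expr0 subrr.
by rewrite big_nat_recr //= IH exprS; ring.
Qed.

(** The last object [o] where [s] and [s'] differ decides. If it is in [s'], then [s'] is heavier,
    as powers of 2 outweigh all smaller ones together. If it is in [s], its whole block is in [s]
    and not in [s'], and for some [j] this block outweighs all earlier ones in profit [j]. *)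
Lemma block_solution_not_dominated (R : realType) (d n : nat)
    (p : 'I_n -> 'I_d -> R) (blk : 'I_n -> nat) (s s' : solution n) :
  (forall i j, 0 <= p i j) ->
  (forall i j : 'I_n, (i <= j)%N -> (blk i <= blk j)%N) ->
  (forall i j, blk i = blk j -> s i = s j) ->
  (forall i j, blk i = blk j -> s' i = s' j) ->
  (forall o, s o -> exists j,
     \sum_(i < n | (blk i < blk o)%N) p i j
       < \sum_(i < n | blk i == blk o) p i j) ->
  ~~ dominates (fun i : 'I_n => 2 ^+ i) p s' s.
Proof.
move=> p0 blkm bs bs' hp; apply/negP => /and3P[wle /forallP ple hlt].
have [i0 hi0] : exists o, s o != s' o.
  apply/existsP; apply: contraLR hlt => /existsPn eqss.
  have -> : s' = s by apply/ffunP => o; have := eqss o; rewrite negbK => /eqP.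
  by rewrite ltxx negb_or /=; apply/existsPn => j; rewrite ltxx.
case: (@arg_maxnP _ i0 (fun i => s i != s' i) val hi0) => o oneq omax.
have eq_above (i : 'I_n) : (o < i)%N -> s i = s' i.
  by move=> oi; apply/eqP; apply: contraTT oi => /omax; rewrite -leqNgt.
case so: (s o); last first.
  have s'o : s' o by move: oneq; rewrite so; case: (s' o).
  suff : weight (fun i : 'I_n => 2 ^+ i : R) s
       < weight (fun i : 'I_n => 2 ^+ i) s' by rewrite ltNge wle.
  apply: (@lt_sum_select _ _ _ _ _ (pred1 o) (fun i => i < o)%N).
  - by move=> i; rewrite exprn_ge0.
  - by move=> i /eqP ->; rewrite s'o so.
  - move=> i /= io; rewrite -leqNgt => oi; apply/esym/eq_above.
    by rewrite ltn_neqAle oi andbT eq_sym.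
  - by rewrite big_pred1_eq sum_pow2_lt.
have s'o : s' o = false by move: oneq; rewrite so; case: (s' o).
have [j hj] := hp o so.
suff : profit p s' j < profit p s j by rewrite ltNge ple.
apply: (@lt_sum_select _ _ (p^~ j) _ _
         (fun i => blk i == blk o) (fun i => blk i < blk o)%N) => //.
- by move=> i /eqP io; rewrite (bs _ _ io) (bs' _ _ io) so s'o.
- move=> i /= io; rewrite -leqNgt => oi; apply: eq_above.
  have : (blk o < blk i)%N by rewrite ltn_neqAle oi andbT eq_sym.
  by apply: contraTT; rewrite -!leqNgt => /blkm.
Qed.

(** * Rounds of blocks: gains, sizes and guaranteed profits *)

Lemma big_divmod (V : Type) (idx : V) (op : Monoid.law idx) (d m : nat)
    (f : nat -> nat -> V) :
  (0 < d)%N ->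
  \big[op/idx]_(0 <= t < m * d) f (t %/ d)%N (t %% d)%N =
  \big[op/idx]_(0 <= r < m) \big[op/idx]_(0 <= j < d) f r j.
Proof.
move=> d0; elim: m => [|m IH]; first by rewrite mul0n !big_geq.
rewrite mulSnr (big_cat_nat (leq0n _) (leq_addr d (m * d))) /= IH.
rewrite big_nat_recr //=; congr (op _ _).
rewrite -{1}[(m * d)%N]add0n big_addn addKn; apply: eq_big_nat => j /andP[_ jd].
by rewrite addnC divnMDl // modnMDl divn_small // addn0 modn_small.
Qed.

Definition gain (R : realType) (d : nat) (phi : R) (r : nat) : R :=
  8 * d%:R ^+ 2 / phi * (2 + d%:R^-1) ^+ r.

(** More than twice the gain, so that each object has to guarantee a profit below 1/2 only. *)
Definition block_size (R : realType) (d : nat) (phi : R) (r : nat) : nat :=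
  (Num.truncn (2 * gain d phi r)).+1.

(* 0 for phi < 16 d^2: then only the empty solution is feasible, and the claimed
   bound is at most 1 because g(phi) = 16 d^2 / phi >= 1.  The last two
   conditions make the blocks of all rounds fit into n objects. *)
Definition rounds (R : realType) (d n : nat) (phi : R) : nat :=
  \max_(r < n.+1 | [&& 16 * d%:R ^+ 2 <= phi, (2 * (d * r) <= n)%N &
                       32 * d%:R ^+ 3 * (2 + d%:R^-1) ^+ r <= n%:R * phi]) r.

(** Block [t] belongs to round [t %/ d] and serves profit [t %% d]. *)
Definition block_shape (R : realType) (d n : nat) (phi : R) : seq nat :=
  mkseq (fun t => block_size d phi (t %/ d)) (rounds d n phi * d).

(* The minimum is attained by its first argument as soon as phi >= 2; the cap
   only keeps [profit_lo, profit_lo + 1 / phi] inside [-1, 1] for small phi. *)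
Definition profit_lo (R : realType) (d : nat) (phi : R) (t j : nat) : R :=
  if j == (t %% d)%N then
    Num.min (gain d phi (t %/ d) / (block_size d phi (t %/ d))%:R) (1 - phi^-1)
  else 0.

Lemma gain_gt0 (R : realType) (d : nat) (phi : R) (r : nat) :
  (0 < d)%N -> 0 < phi -> 0 < gain d phi r.
Proof.
move=> d0 phi0; have D0 : 0 < d%:R :> R by rewrite ltr0n.
by rewrite /gain mulr_gt0 ?divr_gt0 ?mulr_gt0 ?exprn_gt0 ?addr_gt0 ?invr_gt0.
Qed.

Lemma gainS (R : realType) (d : nat) (phi : R) (r : nat) :
  gain d phi r.+1 = (2 + d%:R^-1) * gain d phi r.
Proof. by rewrite /gain [_ ^+ r.+1]exprS [LHS]mulrCA. Qed.

Lemma gain_ge (R : realType) (d : nat) (phi : R) (r : nat) :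
  0 < phi -> 8 * d%:R ^+ 2 / phi <= gain d phi r.
Proof.
move=> phi0; apply: ler_peMr.
  by rewrite divr_ge0 ?mulr_ge0 ?exprn_ge0 // ltW.
have := invr_ge0 (d%:R : R); rewrite ler0n => d0; apply: exprn_ege1; lra.
Qed.

Lemma block_size_bounds (R : realType) (d : nat) (phi : R) (r : nat) :
  (0 < d)%N -> 0 < phi ->
  2 * gain d phi r < (block_size d phi r)%:R <= 2 * gain d phi r + 1.
Proof.
move=> d0 phi0; rewrite /block_size truncnS_gt -natr1 lerD2r /=.
by rewrite truncn_le mulr_ge0 // ltW ?gain_gt0.
Qed.

Lemma profit_lo_itv (R : realType) (d : nat) (phi : R) (t j : nat) :
  (0 < d)%N -> 1 <= phi -> 0 <= profit_lo d phi t j <= 1 - phi^-1.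
Proof.
move=> d0 phi1; have phi0 : 0 < phi by exact: lt_le_trans phi1.
have iphi : 0 <= 1 - phi^-1 by rewrite subr_ge0 invf_le1.
rewrite /profit_lo; case: ifP => _; last by rewrite lexx iphi.
by rewrite ge_min lexx orbT andbT le_min iphi andbT divr_ge0 // ltW ?gain_gt0.
Qed.

Lemma profit_lo_block (R : realType) (d : nat) (phi : R) (t : nat) :
  (0 < d)%N -> 2 <= phi ->
  profit_lo d phi t (t %% d) *+ block_size d phi (t %/ d) = gain d phi (t %/ d).
Proof.
move=> d0 phi2; have phi0 : 0 < phi by exact: lt_le_trans phi2.
have /andP[kl _] := block_size_bounds (t %/ d) d0 phi0.
have z0 := gain_gt0 (t %/ d) d0 phi0.
have k0 : 0 < (block_size d phi (t %/ d))%:R :> R by rewrite ltr0n.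
rewrite /profit_lo eqxx min_l; first by rewrite -[LHS]mulr_natr divfK ?gt_eqF.
have : phi^-1 <= 2^-1 by rewrite lef_pV2 // posrE.
by rewrite ler_pdivrMr //; nra.
Qed.

(* The noise of a whole round is absorbed by the excess 1 / d of the growth
   factor 2 + 1 / d of the gain over 2. *)
Lemma round_noise (R : realType) (d : nat) (phi : R) (r : nat) :
  (0 < d)%N -> 16 * d%:R ^+ 2 <= phi ->
  4 * (phi^-1 *+ (block_size d phi r * d)) <= d%:R^-1 * gain d phi r.
Proof.
move=> d0 hphi; have D0 : 0 < d%:R :> R by rewrite ltr0n.
have phi0 : 0 < phi by apply: lt_le_trans hphi; rewrite mulr_gt0 ?exprn_gt0.
have /andP[_ ku] := block_size_bounds r d0 phi0.
have z0 := gain_gt0 r d0 phi0; have zl := gain_ge d r phi0.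
have e16 : 16 * d%:R ^+ 2 * phi^-1 <= 1 by rewrite ler_pdivrMr // mul1r.
have e0 : 0 <= d%:R ^+ 2 * phi^-1 by rewrite mulr_ge0 ?exprn_ge0 ?invr_ge0 ?ltW.
rewrite -[_ *+ (_ * _)]mulr_natr natrM mulrC ler_pdivlMl //.
rewrite -(mulrA 16) in e16; rewrite -(mulrA 8) in zl.
set e := d%:R ^+ 2 * phi^-1 in e0 e16 zl.
have -> : d%:R * (phi^-1 * ((block_size d phi r)%:R * d%:R) * 4) =
  4 * e * (block_size d phi r)%:R by rewrite /e; ring.
(* With z the gain, the left side is at most 8 e z + 4 e; both terms are at most z / 2, by 16 e <= 1
   and 8 e <= z. *)
have : 0 <= e * (2 * gain d phi r + 1 - (block_size d phi r)%:R).
  by rewrite mulr_ge0 // subr_ge0.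
have : 0 <= gain d phi r * (1 - 16 * e).
  by rewrite mulr_ge0 ?subr_ge0 // ltW.
lra.
Qed.

(** * Accumulated profit of the earlier blocks *)

(* Upper bound for the total profit j of the blocks before block t. *)
Definition load (R : realType) (d : nat) (phi : R) (t j : nat) : R :=
  \sum_(0 <= u < t) (profit_lo d phi u j + phi^-1) *+ block_size d phi (u %/ d).

Lemma load_round (R : realType) (d : nat) (phi : R) (r j i : nat) :
  (j < d)%N -> (i <= d)%N -> 2 <= phi ->
  load d phi (r * d + i) j = load d phi (r * d) j
    + gain d phi r *+ (j < i) + phi^-1 *+ (block_size d phi r * i).
Proof.
move=> jd id phi2; have d0 : (0 < d)%N by apply: leq_ltn_trans jd.
rewrite /load (big_cat_nat (leq0n _) (leq_addr i (r * d))) /= -addrA.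
congr (_ + _); rewrite -{1}[(r * d)%N]add0n big_addn addKn.
rewrite (eq_big_nat _ _ (F2 := fun u =>
  (if u == j then gain d phi r else 0) + phi^-1 *+ block_size d phi r)).
  rewrite big_split /= sumr_const_nat subn0 -mulrnA; congr (_ + _).
  rewrite -big_mkcond /= (@big_nat1_eq _ _ _ _ j 0 i) /=.
  by case: ltnP; rewrite ?mulr1n ?mulr0n.
move=> u /andP[_ ui]; have ud := leq_trans ui id.
rewrite mulrnDl addnC divnMDl // divn_small // addn0; congr (_ + _).
case: eqP => [->|/eqP nuj].
  have := @profit_lo_block _ d phi (r * d + j) d0 phi2.
  by rewrite modnMDl modn_small // divnMDl // divn_small // addn0.
by rewrite /profit_lo modnMDl modn_small // eq_sym (negbTE nuj) mul0rn.
Qed.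

(** The slack 1 / (2 d) reproduces itself from round to round, and it leaves room for the noise of
    the round in progress. *)
Lemma load_le (R : realType) (d : nat) (phi : R) (r j : nat) :
  (j < d)%N -> (2 <= d)%N -> 16 * d%:R ^+ 2 <= phi ->
  load d phi (r * d) j <= (1 - (2 * d%:R)^-1) * gain d phi r.
Proof.
move=> jd d2 hphi; have d0 : (0 < d)%N by apply: leq_ltn_trans jd.
have D2 : 2 <= d%:R :> R by rewrite ler_nat.
have phi2 : 2 <= phi by apply: le_trans hphi; rewrite expr2; nra.
have phi0 : 0 < phi by apply: lt_le_trans phi2.
have D0 : d%:R != 0 :> R by rewrite gt_eqF // ltr0n.
pose E : R := d%:R^-1; have DE : d%:R * E = 1 by rewrite mulfV.
have E0 : 0 < E by rewrite invr_gt0 ltr0n.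
have E2 : 2 * E <= 1 by rewrite -[leRHS]DE ler_wpM2r // ltW.
have -> : (2 * d%:R)^-1 = E / 2 by rewrite invfM mulrC.
elim: r => [|r IH].
  rewrite mul0n /load big_geq // mulr_ge0 ?ltW ?gain_gt0 //; lra.
rewrite mulSnr load_round // jd mulr1n gainS -/E.
have z0 := gain_gt0 r d0 phi0.
have noise := round_noise r d0 hphi.
rewrite -/E in noise; set N := _ *+ (_ * d) in noise *.
(* In units of the gain, the new load is at most (1 - E/2) + 1 + E/4 = 2 - E/4, and the target is (1
   - E/2) (2 + E) = 2 - E^2/2; so 2 E <= 1 suffices. *)
have : 0 <= (1 - 2 * E) * (E * gain d phi r).
  by rewrite mulr_ge0 ?subr_ge0 // mulr_ge0 ?ltW.
move: (gain d phi r) (load _ _ _ _) N E IH noise {z0 DE E0 E2} => z L N E.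
lra.
Qed.

(** The blocks of the current round before [t] add only noise to this profit, at most 1 / (4 d) of
    the gain, which is half of the slack from [load_le]. *)
Lemma load_lt (R : realType) (d : nat) (phi : R) (t : nat) :
  (2 <= d)%N -> 16 * d%:R ^+ 2 <= phi ->
  load d phi t (t %% d)
    < profit_lo d phi t (t %% d) *+ block_size d phi (t %/ d).
Proof.
move=> d2 hphi; have d0 : (0 < d)%N by apply: leq_trans d2.
have D2 : 2 <= d%:R :> R by rewrite ler_nat.
have phi2 : 2 <= phi by apply: le_trans hphi; rewrite expr2; nra.
have phi0 : 0 < phi by apply: lt_le_trans phi2.
have jd : (t %% d < d)%N by rewrite ltn_mod.
rewrite profit_lo_block // {1}(divn_eq t d) load_round ?(ltnW jd) //.
rewrite ltnn mulr0n addr0.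
pose E : R := d%:R^-1; have E0 : 0 < E by rewrite invr_gt0 ltr0n.
have := load_le (t %/ d) jd d2 hphi.
have -> : (2 * d%:R)^-1 = E / 2 by rewrite invfM mulrC.
have z0 := gain_gt0 (t %/ d) d0 phi0.
have noise := round_noise (t %/ d) d0 hphi.
have {}noise : 4 * (phi^-1 *+ (block_size d phi (t %/ d) * (t %% d)))
    <= E * gain d phi (t %/ d).
  apply: le_trans noise; rewrite ler_pM2l //.
  rewrite -[leLHS]mulr_natr -[leRHS]mulr_natr.
  rewrite ler_wpM2l ?invr_ge0 ?(ltW phi0) //.
  by rewrite ler_nat leq_pmul2l // ltnW.
have : 0 < E * gain d phi (t %/ d) by rewrite mulr_gt0.
lra.
Qed.

(** * Fitting the blocks into n objects *)

Lemma rounds_spec (R : realType) (d n : nat) (phi : R) :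
  rounds d n phi = 0%N \/
  [/\ 16 * d%:R ^+ 2 <= phi, (2 * (d * rounds d n phi) <= n)%N &
      32 * d%:R ^+ 3 * (2 + d%:R^-1) ^+ rounds d n phi <= n%:R * phi].
Proof.
rewrite /rounds; elim/big_rec: _ => [|r m /and3P[? ? ?] hm]; first by left.
by case: (leqP r m) => _ //; right.
Qed.

Lemma sum_gain_le (R : realType) (d : nat) (phi : R) (m : nat) :
  (0 < d)%N -> 0 < phi ->
  \sum_(0 <= r < m) gain d phi r <= gain d phi m.
Proof.
move=> d0 phi0; elim: m => [|m IH].
  by rewrite big_geq // ltW ?gain_gt0.
rewrite big_nat_recr //= gainS.
have z0 := gain_gt0 m d0 phi0.
have : 0 <= d%:R^-1 * gain d phi m by rewrite mulr_ge0 // ltW.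
lra.
Qed.

(** For m rounds the total size is at most 2 d z_m + d m, since the earlier gains sum to at most
    z_m; the last two conditions in [rounds] bound each term by n / 2. *)
Lemma sumn_block_shape (R : realType) (d n : nat) (phi : R) :
  (0 < d)%N -> 1 <= phi -> (sumn (block_shape d n phi) <= n)%N.
Proof.
move=> d0 phi1; have phi0 : 0 < phi by exact: lt_le_trans phi1.
have -> : sumn (block_shape d n phi)
    = (d * \sum_(0 <= r < rounds d n phi) block_size d phi r)%N.
  rewrite sumnE big_map -[X in iota 0 X]subn0 -/(index_iota 0 _).
  rewrite (big_divmod _ _ (fun r _ => block_size d phi r)) // big_distrr /=.
  by apply: eq_bigr => r _; rewrite sum_nat_const_nat subn0.
have [->|[_ hn hz]] := rounds_spec d n phi; first by rewrite big_geq // muln0.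
set m := rounds d n phi in hn hz *.
have D0 : 0 < d%:R :> R by rewrite ltr0n.
rewrite -(ler_nat R) natrM natr_sum.
have le_sum : \sum_(0 <= r < m) (block_size d phi r)%:R
    <= 2 * gain d phi m + m%:R :> R.
  apply: (@le_trans _ _ (\sum_(0 <= r < m) (2 * gain d phi r + 1))).
    by apply: ler_sum_nat => r _; have /andP[] := block_size_bounds r d0 phi0.
  rewrite big_split /= -mulr_sumr sumr_const_nat subn0 lerD2r ler_pM2l //.
  exact: sum_gain_le.
apply: le_trans (ler_wpM2l (ltW D0) le_sum) _.
have : 2 * (d%:R * m%:R) <= n%:R :> R by rewrite -!natrM ler_nat.
have : 4 * (d%:R * gain d phi m) <= n%:R.
  apply: le_trans (_ : 32 * d%:R ^+ 3 * (2 + d%:R^-1) ^+ m / phi <= _).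
    by rewrite /gain le_eqVlt; apply/orP; left; apply/eqP; ring.
  by rewrite ler_pdivrMr.
lra.
Qed.

Lemma size_block_shape (R : realType) (d n : nat) (phi : R) :
  size (block_shape d n phi) = (rounds d n phi * d)%N.
Proof. by rewrite size_mkseq. Qed.

(** * The instance and its Pareto set *)

Definition block (R : realType) (d n : nat) (phi : R) (i : 'I_n) : nat :=
  reshape_index (block_shape d n phi) i.

(* Objects left over after the last block form a last group, in which only the
   zero sub-solution is feasible. *)
Definition all_or_nothing (R : realType) (d n : nat) (phi : R) :
    group_knapsack R d n := {|
  kp_k := (rounds d n phi * d).+1;
  kp_group := fun i => inord (block d phi i);
  kp_feasible := fun t => [set x | [exists b : bool,
    (b ==> (t < rounds d n phi * d)%N) && (x == [ffun=> b])]]%SET;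
  kp_weight := fun i => 2 ^+ i;
  kp_density := fun i j x => phi *
    \1_`[profit_lo d phi (block d phi i) j,
         profit_lo d phi (block d phi i) j + phi^-1] x |}.

Lemma feasible_all_or_nothingP (R : realType) (d n : nat) (phi : R)
    (s : solution n) :
  reflect ((forall i j, block d phi i = block d phi j -> s i = s j) /\
           (forall i, s i -> (block d phi i < rounds d n phi * d)%N))
          (s \in feasible_set (all_or_nothing d n phi)).
Proof.
have blk_le (i : 'I_n) : (block d phi i < (rounds d n phi * d).+1)%N.
  by rewrite ltnS -size_block_shape leq_reshape_index_size.
rewrite inE; apply: (iffP forallP) => [hs|[hc hl] t].
  have {}hs (t : 'I_(rounds d n phi * d).+1) : exists b : bool,
      (b -> (t < rounds d n phi * d)%N) /\
      forall i, block d phi i = t -> s i = b.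
    have := hs t; rewrite /= inE => /existsP[b /andP[/implyP bt /eqP sb]].
    exists b; split=> // i it.
    have gi : inord (block d phi i) == t by rewrite -val_eqE /= inordK ?it.
    by have /ffunP/(_ (exist _ i gi)) := sb; rewrite !ffunE.
  split=> [i j ij|i si].
    have [b [_ hb]] := hs (Ordinal (blk_le i)).
    by rewrite (hb i) // (hb j) // ij.
  have [b [bt hb]] := hs (Ordinal (blk_le i)).
  by apply: bt; rewrite -(hb i).
rewrite /= inE; apply/existsP.
have gP (x : {i : 'I_n | inord (block d phi i) == t}) : block d phi (val x) = t.
  by have /eqP/(congr1 val) := valP x; rewrite /= inordK.
case: (pickP (fun x : {i : 'I_n | inord (block d phi i) == t} => true))
  => [x _|no].
  exists (s (val x)); apply/andP; split.
    by apply/implyP => /hl; rewrite gP.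
  by apply/eqP/ffunP => y; rewrite !ffunE; apply: hc; rewrite !gP.
by exists false; apply/eqP/ffunP => y; have := no y.
Qed.

Lemma sum_blocks (R : realType) (d n : nat) (phi : R) (F : nat -> R) :
  (0 < d)%N -> 1 <= phi -> F (rounds d n phi * d)%N = 0 ->
  \sum_(i < n) F (block d phi i) =
  \sum_(0 <= t < rounds d n phi * d) F t *+ block_size d phi (t %/ d).
Proof.
move=> d0 phi1 F0.
rewrite -(big_mkord xpredT (fun i => F (reshape_index (block_shape d n phi) i))).
rewrite sum_reshape_index ?sumn_block_shape // size_block_shape F0 mul0rn addr0.
by apply: eq_big_nat => t /andP[_ tm]; rewrite nth_mkseq.
Qed.

(** For a block [t] of [s], profit [t %% d] meets the criterion: [load] bounds the earlier blocks
    from above, and the left ends of the intervals bound block [t] from below. *)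
Lemma all_or_nothing_pareto (R : realType) (d n : nat) (phi : R)
    (p : 'I_n -> 'I_d -> R) :
  (2 <= d)%N -> 1 <= phi ->
  (forall (i : 'I_n) (j : 'I_d), profit_lo d phi (block d phi i) j <= p i j
               <= profit_lo d phi (block d phi i) j + phi^-1) ->
  pareto_set (kp_weight (all_or_nothing d n phi)) p
             (feasible_set (all_or_nothing d n phi))
  = feasible_set (all_or_nothing d n phi).
Proof.
move=> d2 phi1 hp; have d0 : (0 < d)%N by exact: leq_trans d2.
have phi0 : 0 < phi by exact: lt_le_trans phi1.
apply/setP => s; rewrite inE andb_idr // => sF; apply/forall_inP => s' s'F.
have /feasible_all_or_nothingP[sc sl] := sF.
have /feasible_all_or_nothingP[sc' _] := s'F.
apply: (@block_solution_not_dominated _ _ _ _ (@block R d n phi)) => //.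
- move=> i j; apply: le_trans (_ : _ <= profit_lo d phi (block d phi i) j) _.
    by have /andP[] := profit_lo_itv (block d phi i) j d0 phi1.
  by have /andP[] := hp i j.
- by move=> i j; apply: reshape_index_mono.
move=> o so; have om := sl o so; set t := block d phi o in om *.
(* A chosen object lies in a proper block, so there is at least one round. *)
have hphi : 16 * d%:R ^+ 2 <= phi.
  by have [m0|[]] := rounds_spec d n phi; first by rewrite m0 in om.
have jd : (t %% d < d)%N by rewrite ltn_mod.
exists (Ordinal jd).
apply: (@le_lt_trans _ _ (load d phi t (t %% d))).
  pose F u := if (u < t)%N then profit_lo d phi u (t %% d) + phi^-1 else 0.
  have -> : load d phi t (t %% d) = \sum_(i < n) F (block d phi i).
    rewrite sum_blocks //; last by rewrite /F ltnNge ltnW.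
    rewrite /F /load (big_nat_widen _ _ _ _ _ (ltnW om)) big_mkcond /=.
    by apply: eq_bigr => u _; case: ifP => //; rewrite mul0rn.
  rewrite big_mkcond /F; apply: ler_sum => i _ /=; case: ifP => // _.
  by have /andP[] := hp i (Ordinal jd).
apply: lt_le_trans (load_lt t d2 hphi) _.
pose F u := if u == t then profit_lo d phi u (t %% d) else 0.
have -> : profit_lo d phi t (t %% d) *+ block_size d phi (t %/ d) =
    \sum_(i < n) F (block d phi i).
  rewrite sum_blocks //; last by rewrite /F gtn_eqF.
  rewrite /F (bigD1_seq t) ?mem_index_iota ?iota_uniq //= eqxx big1 ?addr0 //.
  by move=> u /negbTE ->; rewrite mul0rn.
rewrite [leRHS]big_mkcond /F; apply: ler_sum => i _ /=; case: eqP => // it.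
by have /andP[] := hp i (Ordinal jd); rewrite it.
Qed.

(** Every set of blocks may be chosen, and distinct sets give distinct solutions because no block is
    empty. *)
Lemma card_feasible_all_or_nothing (R : realType) (d n : nat) (phi : R) :
  (0 < d)%N -> 1 <= phi ->
  (2 ^ (rounds d n phi * d) <= #|feasible_set (all_or_nothing d n phi)|)%N.
Proof.
move=> d0 phi1; set m := (rounds d n phi * d)%N.
pose sol (sg : {ffun 'I_m -> bool}) : solution n :=
  [ffun i => [exists t : 'I_m, (block d phi i == t) && sg t]].
have solE sg (t : 'I_m) i : block d phi i = t -> sol sg i = sg t.
  move=> it; rewrite ffunE; apply/existsP/idP => [[u /andP[/eqP iu sgu]]|sgt].
    by have -> : t = u by apply: val_inj; exact: etrans (esym it) iu.
  by exists t; apply/andP; split=> //; apply/eqP.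
have hit (t : 'I_m) : exists i : 'I_n, block d phi i = t.
  have lt0 : (0 < nth 0 (block_shape d n phi) t)%N by rewrite nth_mkseq.
  have hi := leq_trans (flatten_indexP lt0) (sumn_block_shape n d0 phi1).
  by exists (Ordinal hi); rewrite /block /= flatten_indexKl.
have sol_inj : injective sol.
  move=> a b /ffunP ab; apply/ffunP => t; have [i it] := hit t.
  by rewrite -(solE a t i it) -(solE b t i it).
have -> : (2 ^ m)%N = #|[set sol sg | sg in [set: {ffun 'I_m -> bool}]]%SET|.
  by rewrite card_imset // cardsT card_ffun card_bool card_ord.
apply/subset_leq_card/fintype.subsetP => _ /imsetP[sg _ ->].
apply/feasible_all_or_nothingP; split=> [i j ij|i].
  by rewrite !ffunE ij.
by rewrite ffunE => /existsP[t /andP[/eqP -> _]].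
Qed.

(** * From almost sure bounds to the expectation *)

(** The integral is a supremum over simple functions below [X], and [c] times the indicator of the
    complement of a null set is one of them. *)
Lemma expectation_ge_ae (dT : measure_display) (T : measurableType dT)
    (R : realType) (P : probability T R) (X : T -> R) (c : R) :
  0 <= c -> (forall t, 0 <= X t) -> (\forall t \ae P, c <= X t) ->
  (c%:E <= 'E_P[X])%E.
Proof.
move=> c0 X0 [N [mN PN0 cXN]].
have mA := measurableC mN.
have PA1 : P (~` N) = 1%E by rewrite probability_setC // PN0 sube0.
rewrite unlock ge0_integralTE => [|t]; last by rewrite lee_fin.
apply: ereal_sup_ubound; exists (scale_nnsfun (indic_nnsfun R mA) c0).
  move=> t; rewrite lee_fin -[leLHS]/(c * \1_(~` N) t) indicE.
  have [tN|tN] := boolP (t \in ~` N); last by rewrite mulr0.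
  by rewrite mulr1 leNgt; apply/negP => ltXc; apply: (set_mem tN); apply: cXN;
    rewrite /= leNgt ltXc.
rewrite sintegralrM -[X in sintegral _ X]/(\1_(~` N)) sintegral_indic.
by rewrite [X in (_ * X)%E]PA1 mule1.
Qed.

Lemma is_density_uniform (R : realType) (phi a : R) :
  1 <= phi -> 0 <= a <= 1 - phi^-1 ->
  is_density (fun x => phi * \1_`[a, a + phi^-1] x).
Proof.
move=> phi1 /andP[a0 a1]; have phi0 : 0 < phi by exact: lt_le_trans phi1.
have iphi : 0 < phi^-1 by rewrite invr_gt0.
split.
- apply: measurable_funM; first exact: measurable_cst.
  exact: measurable_indic.
- by move=> x _; rewrite mulr_ge0 // ltW.
under eq_integral do rewrite EFinM.
rewrite ge0_integralZl_EFin //; first last.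
- exact: ltW.
- by apply/measurable_EFinP; exact: measurable_indic.
rewrite integral_indic // setIidl; last first.
  by move=> x /=; rewrite !in_itv /= => /andP[? ?]; apply/andP; split; lra.
rewrite [X in (_ * X)%E]lebesgue_measure_itv /= lte_fin ltrDl iphi -EFinB -EFinM.
by rewrite addrAC subrr add0r mulfV // gt_eqF.
Qed.

Lemma has_density_uniform_ae (dT : measure_display) (T : measurableType dT)
    (R : realType) (P : probability T R) (X : {RV P >-> R}) (phi a : R) :
  has_density X (fun x => phi * \1_`[a, a + phi^-1] x) ->
  \forall t \ae P, a <= X t <= a + phi^-1.
Proof.
move=> dX; exists (X @^-1` (~` `[a, a + phi^-1])).
split; last by move=> t /=; rewrite in_itv.
- rewrite -[X in measurable X]setTI; apply: measurable_funPT => //.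
  exact: measurableC.
rewrite -[LHS]/(distribution P X _) dX; last exact: measurableC.
by apply: integral0_eq => x [xN _]; rewrite indicE memNset // mulr0.
Qed.

Lemma expected_pareto_ge (dT : measure_display) (T : measurableType dT)
    (R : realType) (P : probability T R) (d n : nat) (phi : R)
    (p : 'I_n -> 'I_d -> {RV P >-> R}) :
  (2 <= d)%N -> 1 <= phi -> drawn_from (all_or_nothing d n phi) p ->
  (((2 ^ (rounds d n phi * d))%N%:R : R)%:E
    <= expected_pareto (all_or_nothing d n phi) p)%E.
Proof.
move=> d2 phi1 [_ dp]; have d0 : (0 < d)%N by exact: leq_trans d2.
apply: expectation_ge_ae => //.
have : \forall t \ae P, forall (i : 'I_n) (j : 'I_d),
      profit_lo d phi (block d phi i) j <= p i j t
    <= profit_lo d phi (block d phi i) j + phi^-1.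
  by do 2!apply: filter_forall => ?; exact/has_density_uniform_ae/dp.
apply: filterS => t pt; rewrite ler_nat all_or_nothing_pareto //.
exact: card_feasible_all_or_nothing.
Qed.

Lemma valid_all_or_nothing (R : realType) (d n : nat) (phi : R) :
  (2 <= d)%N -> 1 <= phi -> valid_smoothing phi (all_or_nothing d n phi).
Proof.
move=> d2 phi1 i j; have d0 : (0 < d)%N by exact: leq_trans d2.
split; first exact/is_density_uniform/profit_lo_itv.
have phi0 : 0 <= phi by exact: le_trans phi1.
by move=> x _ /=; rewrite indicE; case: (x \in _); rewrite ?mulr1 ?mulr0.
Qed.

(** * The asymptotic lower bound *)

Lemma pow_base_le (R : realType) (d : nat) :
  (0 < d)%N -> (2 + d%:R^-1) ^+ d.-1 <= 2 ^+ d :> R.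
Proof.
move=> d0; have D0 : 0 < d%:R :> R by rewrite ltr0n.
pose E : R := d%:R^-1; have DE : d%:R * E = 1 by rewrite mulfV ?gt_eqF.
have E0 : 0 < E by rewrite invr_gt0.
(* A converse to Bernoulli's inequality: the doubled slope absorbs the quadratic term while
   [k * E <= 1]. *)
have bern k : (k <= d)%N -> (2 + E) ^+ k <= 2 ^+ k * (1 + k%:R * E).
  elim: k => [|k IH] kd; first by rewrite !expr0 mul0r addr0 mulr1.
  have kE : k%:R * E <= 1 by rewrite -[leRHS]DE ler_pM2r // ler_nat ltnW.
  have k0 : 0 <= k%:R * E by rewrite mulr_ge0 // ltW.
  rewrite !exprS; apply: le_trans (ler_wpM2l _ (IH (ltnW kd))) _; first lra.
  rewrite [leLHS]mulrCA [2 * _]mulrC -[leRHS]mulrA ler_pM2l ?exprn_gt0 //.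
  rewrite -[k.+1%:R]natr1.
  have : 0 <= (1 - k%:R * E) * E by rewrite mulr_ge0 ?subr_ge0 // ltW.
  lra.
apply: le_trans (bern d.-1 (leq_pred _)) _.
rewrite -[in leRHS](prednK d0) exprSr ler_pM2l ?exprn_gt0 //.
have : d.-1%:R * E <= 1 by rewrite -[leRHS]DE ler_pM2r // ler_nat leq_pred.
lra.
Qed.

(** The lower bound gives d - log d <= d - 1; the upper one makes d - log d nonnegative. *)
Lemma log2_nat_itv (R : realType) (d : nat) :
  (2 <= d)%N -> 1 <= log2 (d%:R : R) <= d%:R.
Proof.
move=> d2; have d0 : (0 < d)%N by exact: leq_trans d2.
have l2 : 0 < ln 2 :> R by rewrite ln_gt0 // ltr1n.
rewrite /log2 ler_pdivlMr // ler_pdivrMr // mul1r -ln_powR.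
rewrite !ler_ln ?posrE ?ltr0n ?powR_gt0 // powR_mulrn //.
by rewrite -natrX !ler_nat d2 ltnW // ltn_expl.
Qed.

Lemma rounds_max (R : realType) (d n : nat) (phi : R) :
  (0 < d)%N -> 16 * d%:R ^+ 2 <= phi ->
  (n < 2 * (d * (rounds d n phi).+1))%N \/
  n%:R * phi < 32 * d%:R ^+ 3 * (2 + d%:R^-1) ^+ (rounds d n phi).+1.
Proof.
move=> d0 hphi; set m := (rounds d n phi).+1.
case: (ltnP n (2 * (d * m))) => [|hn]; [by left | right].
rewrite ltNge; apply/negP => hz.
have mn : (m < n.+1)%N by nia.
suff : (m <= rounds d n phi)%N by rewrite ltnn.
apply: (@leq_bigmax_cond _ _ (@nat_of_ord n.+1) (Ordinal mn)).
by rewrite hphi hn hz.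
Qed.

Lemma min_bound_le (R : realType) (d n : nat) (phi : R) :
  (2 <= d)%N -> (1 <= n)%N -> 1 <= phi ->
  ((96 * d%:R ^+ 3) ^+ d)^-1 * Num.min
    ((n%:R * phi) `^ ((d%:R - log2 d%:R) * (1 - 16 * d%:R ^+ 2 * phi^-1)))
    (2 `^ (2^-1 * n%:R)) <= (2 ^ (rounds d n phi * d))%N%:R :> R.
Proof.
move=> d2 n1 phi1; have d0 : (0 < d)%N by exact: leq_trans d2.
have phi0 : 0 < phi by exact: lt_le_trans phi1.
have D1 : 1 <= d%:R :> R by rewrite ler1n.
have np1 : 1 <= n%:R * phi by rewrite mulr_ege1 // ler1n.
set C := 96 * d%:R ^+ 3.
have C96 : 96 <= C by rewrite ler_peMr // exprn_ege1.
have C1 : 1 <= C by apply: le_trans C96; rewrite ler1n.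
have C0 : 0 < C by exact: lt_le_trans C1.
have /andP[l1 ld] := @log2_nat_itv R d d2.
rewrite ler_pdivrMl ?exprn_gt0 // ge_min natrX; apply/orP.
have [hphi|hphi] := ltP phi (16 * d%:R ^+ 2).
  (* Here the exponent is at most 0 and the base at least 1. *)
  left; apply: (@le_trans _ _ 1); last first.
    by rewrite mulr_ege1 ?exprn_ege1 // ler1n.
  rewrite -[leRHS](powRr0 (n%:R * phi)) ler_powR //.
  rewrite mulr_ge0_le0 ?subr_ge0 // subr_le0 ler_pdivlMr // mul1r ltW //.
have g1 : 16 * d%:R ^+ 2 * phi^-1 <= 1 by rewrite ler_pdivrMr // mul1r.
have g0 : 0 <= 16 * d%:R ^+ 2 * phi^-1 by rewrite divr_ge0 ?mulr_ge0 // ltW.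
have [hn|hz] := rounds_max n d0 hphi; [right | left].
  (* The number of objects stops a further round: n / 2 is at most d more than the number of blocks,
     and C^d pays for 2^d. *)
  apply: (@le_trans _ _ (2 `^ (d + rounds d n phi * d)%:R)).
    apply: ler_powR; first by rewrite ler1n.
    rewrite ler_pdivrMl // -natrM ler_nat -mulSn; nia.
  rewrite powR_mulrn // exprD ler_pM2r ?exprn_gt0 //.
  rewrite lerXn2r ?nnegrE ?(ltW C0) //.
  by apply: le_trans C96; rewrite ler_nat.
have dm1 : d.-1%:R = d%:R - 1 :> R by rewrite -subn1 natrB.
apply: (@le_trans _ _ ((n%:R * phi) `^ d.-1%:R)).
  apply: ler_powR => //; rewrite dm1.
  have : 0 <= (d%:R - log2 d%:R) * (16 * d%:R ^+ 2 * phi^-1).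
    by rewrite mulr_ge0 // subr_ge0.
  lra.
rewrite powR_mulrn; last exact: le_trans np1.
apply: le_trans (_ : (C * (2 + d%:R^-1) ^+ rounds d n phi) ^+ d.-1 <= _).
  have B3 : 2 + d%:R^-1 <= 3 :> R.
    have : d%:R^-1 <= 1 :> R by rewrite invf_le1 // (lt_le_trans _ D1).
    lra.
  have B0 : 0 <= 2 + d%:R^-1 :> R by rewrite addr_ge0 // invr_ge0.
  have e3 : 0 <= d%:R ^+ 3 :> R by rewrite exprn_ge0.
  apply: lerXn2r; rewrite ?nnegrE ?mulr_ge0 ?exprn_ge0 ?(ltW C0) ?(ltW phi0) //.
  apply: le_trans (ltW hz) _; rewrite [(2 + _) ^+ _]exprS mulrA.
  rewrite ler_wpM2r ?exprn_ge0 //.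
  have : 0 <= d%:R ^+ 3 * (3 - (2 + d%:R^-1)) :> R.
    by rewrite mulr_ge0 // subr_ge0.
  by rewrite /C; lra.
rewrite exprMn; apply: ler_pM.
- by rewrite exprn_ge0 ?ltW.
- by rewrite !exprn_ge0 // addr_ge0 // invr_ge0.
- by rewrite ler_weXn2l // leq_pred.
(* Exchanging the exponents reduces the claim to a single round. *)
rewrite exprAC mulnC exprM lerXn2r ?nnegrE ?exprn_ge0 ?addr_ge0 ?invr_ge0 //.
exact: pow_base_le.
Qed.

Theorem theorem3 (R : realType) (d : nat) (hd : (2 <= d)%N) :
  exists I : forall n : nat, R -> group_knapsack R d n,
    (forall (n : nat) (phi : R), (1 <= n)%N -> 1 <= phi ->
       valid_smoothing phi (I n phi)) /\
    exists (g h : nat -> R -> R) (c : R),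
      [/\ is_Theta g (fun _ phi => phi^-1),
          is_Theta h (fun n _ => n%:R),
          0 < c &
          forall (n : nat) (phi : R), (1 <= n)%N -> 1 <= phi ->
          forall (dT : measure_display) (T : measurableType dT)
                 (P : probability T R) (p : 'I_n -> 'I_d -> {RV P >-> R}),
            drawn_from (I n phi) p ->
            ((c * Num.min
                    ((n%:R * phi)
                       `^ ((d%:R - log2 d%:R) * (1 - g n phi)))
                    (2 `^ h n phi))%:E
             <= expected_pareto (I n phi) p)%E].
Proof.
have d0 : (0 < d)%N by exact: leq_trans hd.
have D0 : 0 < d%:R :> R by rewrite ltr0n.
exists (all_or_nothing d); split.
  by move=> n phi _ phi1; exact: valid_all_or_nothing.
exists (fun _ phi => 16 * d%:R ^+ 2 * phi^-1), (fun n _ => 2^-1 * n%:R).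
exists ((96 * d%:R ^+ 3) ^+ d)^-1; split.
- by exists (16 * d%:R ^+ 2), (16 * d%:R ^+ 2); split;
    rewrite ?mulr_gt0 ?exprn_gt0 // => n phi _ _; rewrite lexx.
- by exists 2^-1, 2^-1; split; rewrite ?invr_gt0 // => n phi _ _; rewrite lexx.
- by rewrite invr_gt0 exprn_gt0 ?mulr_gt0 ?exprn_gt0.
move=> n phi n1 phi1 dT T P p drawn.
apply: le_trans (expected_pareto_ge hd phi1 drawn).
by rewrite lee_fin min_bound_le.
Qed.
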